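(* Let $(G,d)$ be a group with a two-sided invariant metric, let $A,B\le G$ be closed subgroups and $\phi:A\to B$ a group isomorphism which is a $d$-isometry. Let $H=\langle G,t\mid tat^{-1}=\phi(a),\ a\in A\rangle$ be the (abstract) HNN extension of $(G,\phi)$ with stable letter $t$. If $K>0$ and $\operatorname{diam}_d(A)\le K$, then there is a two-sided invariant metric $\underline d$ on $H$ such that $\underline d|_G=d$ and $\underline d(t,e)=K$.
   Context: $\operatorname{diam}_d(A)=\sup\{d(a_1,a_2):a_1,a_2\in A\}$. A two-sided invariant metric satisfies $d(gf_1,gf_2)=d(f_1,f_2)=d(f_1g,f_2g)$. *)

(* Defs.v *)
From Stdlib Require Import Reals.
Open Scope R_scope.

Record Group : Type := {
  carrier :> Type;
  gmul : carrier -> carrier -> carrier;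
  gone : carrier;
  ginv : carrier -> carrier;
  gmul_assoc : forall x y z, gmul x (gmul y z) = gmul (gmul x y) z;
  gmul_one_l : forall x, gmul gone x = x;
  gmul_one_r : forall x, gmul x gone = x;
  gmul_inv_l : forall x, gmul (ginv x) x = gone;
  gmul_inv_r : forall x, gmul x (ginv x) = gone
}.

Arguments gmul {g}.
Arguments gone {g}.
Arguments ginv {g}.

Definition is_metric {X : Type} (d : X -> X -> R) : Prop :=
  (forall x y, 0 <= d x y) /\
  (forall x y, d x y = 0 <-> x = y) /\
  (forall x y, d x y = d y x) /\
  (forall x y z, d x z <= d x y + d y z).

Definition two_sided_invariant {G : Group} (d : G -> G -> R) : Prop :=
  forall g f1 f2, d (gmul g f1) (gmul g f2) = d f1 f2 /\
                  d (gmul f1 g) (gmul f2 g) = d f1 f2.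

Definition is_subgroup {G : Group} (A : G -> Prop) : Prop :=
  A gone /\ (forall x y, A x -> A y -> A (gmul x y)) /\
  (forall x, A x -> A (ginv x)).

Definition is_closed {G : Group} (d : G -> G -> R) (A : G -> Prop) : Prop :=
  forall x, (forall eps, 0 < eps -> exists a, A a /\ d x a < eps) -> A x.

Definition is_hom {G H : Group} (f : G -> H) : Prop :=
  forall x y, f (gmul x y) = gmul (f x) (f y).

Definition diam_le {G : Group} (d : G -> G -> R) (A : G -> Prop) (K : R) : Prop :=
  forall a1 a2, A a1 -> A a2 -> d a1 a2 <= K.

(* (H, i, t) is the HNN extension  < G, t | t a t^-1 = phi a, a in A >,
   characterised (as any group presentation) by its universal property. *)
Definition is_HNN_extension {G : Group} (A : G -> Prop) (phi : G -> G)
    (H : Group) (i : G -> H) (t : H) : Prop :=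
  is_hom i /\
  (forall a, A a -> gmul (gmul t (i a)) (ginv t) = i (phi a)) /\
  (forall (L : Group) (j : G -> L) (s : L),
      is_hom j ->
      (forall a, A a -> gmul (gmul s (j a)) (ginv s) = j (phi a)) ->
      exists f : H -> L,
        (is_hom f /\ (forall g, f (i g) = j g) /\ f t = s) /\
        (forall f' : H -> L,
            is_hom f' -> (forall g, f' (i g) = j g) -> f' t = s ->
            forall h, f' h = f h)).

(* Main.v *)
Require Import Defs.
From Stdlib Require Import Reals Lra Lia List Bool.
From Stdlib Require Import Classical FunctionalExtensionality PropExtensionality.
Import ListNotations.
Open Scope R_scope.

(** An element of the extension is a product of conjugates [p t^e p^-1] with
    [p] in [G], times an element of [G]; the conjugates are the letters of a
    word. Such a word is moved to an element of [G] by a partial noncrossing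
    matching of its letters: a matched pair is a pinch and costs nothing, an
    unmatched letter is deleted and costs [K], and elements of [G] may be
    perturbed at the price of their [d]-distance. The infimum of these costs is
    a conjugation invariant norm.

    The norm does not depend on the word representing an element, because a
    matching survives the cancellation of [t t^-1] and the relation
    [t a = phi(a) t] without increase of cost; the only place where the
    diameter bound enters is the cancellation of two unmatched letters, which
    saves [2 K] and may cost [d(a, phi a) <= 2 K]. That words representing the
    same element are related by these two moves is seen by letting the extension
    act on the functions of words invariant under them.

    The norm agrees with [d] on [G] since the empty word has no letter to
    match, and the norm of [t] is at least [K] by counting the exponent of
    [t]. A reduced word with letters has norm at least [min(K, delta)], where
    [delta] is the least distance of its would-be pinches to the (closed)
    associated subgroups. *)

Local Infix "**" := gmul (at level 40, left associativity).
Local Notation "x ^-1" := (ginv x) (at level 3, format "x ^-1").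

(** * Identities in groups, and homomorphisms *)

Section GroupFacts.
Context {G : Group}.
Implicit Types x y z : G.

Lemma gmul_cancel_l x y z : x ** y = x ** z -> y = z.
Proof.
  intro E. rewrite <- (gmul_one_l _ y), <- (gmul_inv_l _ x), <- gmul_assoc, E.
  now rewrite gmul_assoc, gmul_inv_l, gmul_one_l.
Qed.

Lemma ginv_unique x y : x ** y = gone -> y = x^-1.
Proof. intro E. apply (gmul_cancel_l x). now rewrite E, gmul_inv_r. Qed.

Lemma ginv_mul x y : (x ** y)^-1 = y^-1 ** x^-1.
Proof.
  symmetry. apply ginv_unique.
  now rewrite <- gmul_assoc, (gmul_assoc _ y), gmul_inv_r, gmul_one_l, gmul_inv_r.
Qed.

Lemma ginv_ginv x : (x^-1)^-1 = x.
Proof. symmetry. apply ginv_unique, gmul_inv_l. Qed.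

Lemma ginv_one : gone^-1 = gone :> G.
Proof. symmetry. apply ginv_unique, gmul_one_l. Qed.

Lemma gmul_inv_mul x y : x^-1 ** (x ** y) = y.
Proof. now rewrite gmul_assoc, gmul_inv_l, gmul_one_l. Qed.

Lemma gmul_mul_inv x y : x ** (x^-1 ** y) = y.
Proof. now rewrite gmul_assoc, gmul_inv_r, gmul_one_l. Qed.

Lemma gmul_assoc_r x y z : x ** y ** z = x ** (y ** z).
Proof. symmetry. apply gmul_assoc. Qed.

End GroupFacts.

Hint Rewrite @ginv_mul @ginv_ginv @ginv_one @gmul_inv_mul @gmul_mul_inv
  @gmul_assoc_r gmul_one_l gmul_one_r gmul_inv_l gmul_inv_r : group_nf.

Ltac group_nf := autorewrite with group_nf.
Ltac group := group_nf; reflexivity.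

Lemma hom_one {G L : Group} (f : G -> L) : is_hom f -> f gone = gone.
Proof.
  intro Hf. apply (gmul_cancel_l (f gone)).
  now rewrite <- Hf, !gmul_one_r.
Qed.

Lemma hom_inv {G L : Group} (f : G -> L) x : is_hom f -> f x^-1 = (f x)^-1.
Proof.
  intro Hf. apply ginv_unique. now rewrite <- Hf, gmul_inv_r, hom_one.
Qed.

(** * Subgroups and symmetric groups, the targets for the universal property *)

Section SubgroupGroup.
Context {G : Group} (S : G -> Prop) (HS : is_subgroup S).

Definition subgroup_carrier : Type := {x : G | S x}.

Lemma subgroup_carrier_eq (x y : subgroup_carrier) : proj1_sig x = proj1_sig y -> x = y.
Proof. destruct x as [x Sx], y as [y Sy]. cbn. intros <-. f_equal. apply proof_irrelevance. Qed.

Definition subgroup_group : Group.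
Proof.
  refine {| carrier := subgroup_carrier;
    gmul := fun x y => exist _ (proj1_sig x ** proj1_sig y)
      (proj1 (proj2 HS) _ _ (proj2_sig x) (proj2_sig y));
    gone := exist _ gone (proj1 HS);
    ginv := fun x => exist _ (proj1_sig x)^-1 (proj2 (proj2 HS) _ (proj2_sig x)) |};
  intros; apply subgroup_carrier_eq; cbn; group.
Defined.

End SubgroupGroup.

Section SymmetricGroup.
Context (Y : Type).

Record permutation : Type := {
  fwd : Y -> Y;
  bwd : Y -> Y;
  bwd_fwd : forall y, bwd (fwd y) = y;
  fwd_bwd : forall y, fwd (bwd y) = y
}.

Lemma permutation_eq (s s' : permutation) :
  (forall y, fwd s y = fwd s' y) -> s = s'.
Proof.
  intro E.
  assert (Eb : forall y, bwd s y = bwd s' y).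
  { intro y. now rewrite <- (fwd_bwd s' y) at 1; rewrite <- E, bwd_fwd. }
  destruct s, s'; cbn in *.
  apply functional_extensionality in E as ->. apply functional_extensionality in Eb as ->.
  f_equal; apply proof_irrelevance.
Qed.

Definition symmetric_group : Group.
Proof.
  refine {| carrier := permutation;
    gmul := fun s s' => {| fwd := fun y => fwd s (fwd s' y); bwd := fun y => bwd s' (bwd s y) |};
    gone := {| fwd := fun y => y; bwd := fun y => y |};
    ginv := fun s => {| fwd := bwd s; bwd := fwd s;
      bwd_fwd := fwd_bwd s; fwd_bwd := bwd_fwd s |} |};
  intros; try apply permutation_eq; cbn; intros; now rewrite ?bwd_fwd, ?fwd_bwd.
Unshelve.
  all: intros; cbn; now rewrite ?bwd_fwd, ?fwd_bwd.
Defined.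

End SymmetricGroup.

(** * Locating a letter in a concatenation *)

Section ListFacts.
Context {X : Type}.
Implicit Types (a b c : X) (l w : list X).

Lemma app_eq_middle w1 w2 l1 c l2 :
  w1 ++ w2 = l1 ++ c :: l2 ->
  (exists m, w1 = l1 ++ c :: m /\ l2 = m ++ w2) \/
  (exists m, w2 = m ++ c :: l2 /\ l1 = w1 ++ m).
Proof.
  revert l1. induction w1 as [|a w1 IH]; intros l1 E.
  - right. exists l1. auto.
  - destruct l1 as [|b l1]; injection E as -> E.
    + left. exists w1. auto.
    + destruct (IH _ E) as [(m & -> & ->)|(m & -> & ->)]; [left|right]; now exists m.
Qed.

Lemma bracket_eq_middle a w b l1 c l2 :
  a :: w ++ [b] = l1 ++ c :: l2 ->
  (l1 = [] /\ a = c /\ l2 = w ++ [b]) \/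
  (l2 = [] /\ b = c /\ l1 = a :: w) \/
  (exists m1 m2, l1 = a :: m1 /\ l2 = m2 ++ [b] /\ w = m1 ++ c :: m2).
Proof.
  destruct l1 as [|a' l1]; intro E; injection E as -> E; [now left|right].
  destruct (app_eq_middle _ _ _ _ _ E) as [(m & -> & ->)|(m & E' & ->)].
  - right. eauto.
  - destruct m as [|b' m]; injection E' as -> E'.
    + left. now rewrite app_nil_r.
    + now destruct m.
Qed.

End ListFacts.

(** * Partial matchings of words *)

Section Words.
(** [Gam true] stands for the graph of the isomorphism and [Gam false] for the converse relation, so
    that one argument serves both signs of the stable letter. *)
Context {G : Group} (d : G -> G -> R) (Gam : bool -> G -> G -> Prop) (K : R).
Context (Hd : is_metric d) (Hinv : two_sided_invariant d) (HK : 0 < K).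
Context (Gam_flip : forall e x y, Gam e x y -> Gam (negb e) y x)
  (Gam_one : forall e, Gam e gone gone)
  (Gam_mul : forall e x y x' y', Gam e x y -> Gam e x' y' -> Gam e (x ** x') (y ** y'))
  (Gam_inv : forall e x y, Gam e x y -> Gam e x^-1 y^-1)
  (Gam_isom : forall e x y x' y', Gam e x y -> Gam e x' y' -> d x x' = d y y')
  (Gam_diam : forall e x y, Gam e x y -> d x gone <= K).

Lemma d_nonneg x y : 0 <= d x y.
Proof. apply Hd. Qed.

Lemma d_refl x : d x x = 0.
Proof. now apply Hd. Qed.

Lemma d_sym x y : d x y = d y x.
Proof. apply Hd. Qed.

Lemma d_triangle x y z : d x z <= d x y + d y z.
Proof. apply Hd. Qed.

Lemma d_shift x y u v : d (x ** u ** y) (x ** v ** y) = d u v.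
Proof. now rewrite (proj2 (Hinv _ _ _)), (proj1 (Hinv _ _ _)). Qed.

Lemma d_inv u v : d u^-1 v^-1 = d u v.
Proof.
  rewrite <- (d_shift u v). rewrite d_sym. f_equal; group.
Qed.

Lemma Gam_dist e x y : Gam e x y -> d x y <= 2 * K.
Proof.
  intro E. pose proof (d_triangle x gone y). pose proof (Gam_diam _ _ _ E).
  pose proof (Gam_diam _ _ _ (Gam_flip _ _ _ E)). rewrite (d_sym gone) in *. lra.
Qed.

Notation letter := (G * bool)%type.
Notation word := (list letter).
Implicit Types (l w : word) (e f : bool) (p q g h : G) (r s : R).

(* The letter [(p, e)] stands for [p t^e p^-1], and [Gam e x y] for the relation
   [t^e x t^-e = y]. In [near_del], the deleted letter [t^e] becomes [y z^-1]
   because [t^e = y t^e z^-1]. *)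
Inductive near : word -> G -> R -> Prop :=
| near_nil : near [] gone 0
| near_app l h r l' h' r' :
    near l h r -> near l' h' r' -> near (l ++ l') (h ** h') (r + r')
| near_del p e z y : Gam e z y -> near [(p, e)] (p ** y ** z^-1 ** p^-1) K
| near_bracket p q e l h r y :
    near l h r -> Gam e (p^-1 ** h ** q) y ->
    near ((p, e) :: l ++ [(q, negb e)]) (p ** y ** q^-1) r
| near_approx l h r h' r' : near l h r -> r + d h h' <= r' -> near l h' r'.

Lemma near_eq l h r h' r' : near l h r -> h = h' -> r <= r' -> near l h' r'.
Proof. intros N <- L. apply (near_approx _ _ _ _ _ N). rewrite d_refl. lra. Qed.

Lemma near_app_eq l1 h1 r1 l2 h2 r2 h r :
  near l1 h1 r1 -> near l2 h2 r2 -> h1 ** h2 = h -> r1 + r2 <= r ->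
  near (l1 ++ l2) h r.
Proof. intros N1 N2. apply near_eq, near_app; assumption. Qed.

Lemma near_bracket_eq p q e l g r x y h :
  near l g r -> Gam e x y -> x = p^-1 ** g ** q -> p ** y ** q^-1 = h ->
  near ((p, e) :: l ++ [(q, negb e)]) h r.
Proof. intros N E -> <-. now apply near_bracket with g. Qed.

Lemma near_del_eq p e z y h :
  Gam e z y -> p ** y ** z^-1 ** p^-1 = h -> near [(p, e)] h K.
Proof. intros E <-. now apply near_del. Qed.

Lemma near_nonneg l h r : near l h r -> 0 <= r.
Proof.
  induction 1; try lra. pose proof (d_nonneg h h'). lra.
Qed.

Lemma near_nil_dist h r : near [] h r -> d gone h <= r.
Proof.
  intro N. remember [] as w eqn:Ew. induction N; try discriminate.
  - rewrite d_refl. lra.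
  - apply app_eq_nil in Ew as [-> ->].
    specialize (IHN1 eq_refl). specialize (IHN2 eq_refl).
    pose proof (d_triangle gone h (h ** h')).
    rewrite <- (d_shift h gone) in IHN2. rewrite !gmul_one_r in IHN2. lra.
  - specialize (IHN Ew). pose proof (d_triangle gone h h'). lra.
Qed.

(** * Conjugation and inversion of words *)

Definition shift (k : G) (l : word) : word := map (fun a => (k ** fst a, snd a)) l.

Lemma shift_app k l l' : shift k (l ++ l') = shift k l ++ shift k l'.
Proof. apply map_app. Qed.

Lemma shift_shift k k' l : shift k (shift k' l) = shift (k ** k') l.
Proof.
  unfold shift. rewrite map_map. apply map_ext. intros [p e]. cbn. f_equal. group.
Qed.

Lemma shift_one l : shift gone l = l.
Proof.
  rewrite <- map_id. apply map_ext. intros [p e]. cbn. f_equal. group.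
Qed.

Lemma near_conj k l h r :
  near l h r -> near (shift k l) (k ** h ** k^-1) r.
Proof.
  induction 1 as [|l h r l' h' r' N1 I1 N2 I2|p e z y E|p q e l h r y N I E|l h r h' r' N I L].
  - apply (near_eq _ _ _ _ _ near_nil); [group|lra].
  - rewrite shift_app. apply (near_app_eq _ _ _ _ _ _ _ _ I1 I2); [group|lra].
  - apply (near_del_eq _ _ _ _ _ E). group.
  - cbn. unfold shift. rewrite map_app. apply (near_bracket_eq _ _ _ _ _ _ _ _ _ I E); group.
  - apply (near_approx _ _ _ _ _ I). now rewrite d_shift.
Qed.

Definition flip (a : letter) : letter := (fst a, negb (snd a)).
Definition mirror (l : word) : word := rev (map flip l).

Lemma mirror_app l l' : mirror (l ++ l') = mirror l' ++ mirror l.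
Proof. unfold mirror. now rewrite map_app, rev_app_distr. Qed.

Lemma mirror_cons a l : mirror (a :: l) = mirror l ++ [flip a].
Proof. reflexivity. Qed.

Lemma mirror_mirror l : mirror (mirror l) = l.
Proof.
  unfold mirror. rewrite map_rev, rev_involutive, map_map.
  rewrite (map_ext _ (fun a => a)); [apply map_id|].
  intros [p e]. unfold flip. cbn. now rewrite negb_involutive.
Qed.

Lemma near_mirror l h r : near l h r -> near (mirror l) h^-1 r.
Proof.
  induction 1 as [|l h r l' h' r' N1 I1 N2 I2|p e z y E|p q e l h r y N I E|l h r h' r' N I L].
  - apply (near_eq _ _ _ _ _ near_nil); [group|lra].
  - rewrite mirror_app. apply (near_app_eq _ _ _ _ _ _ _ _ I2 I1); [group|lra].
  - apply (near_del_eq _ _ _ _ _ (Gam_flip _ _ _ E)). group.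
  - rewrite mirror_cons, mirror_app.
    change (near ((q, negb (negb e)) :: mirror l ++ [(p, negb e)]) (p ** y ** q^-1)^-1 r).
    rewrite negb_involutive.
    apply (near_bracket_eq _ _ _ _ _ _ _ _ _ I (Gam_inv _ _ _ E)); group.
  - apply (near_approx _ _ _ _ _ I). now rewrite d_inv.
Qed.

(** The two fates of a final letter [(p, e)]: deleted for the price [K], or matched with an earlier
    [(p0, negb e)], which cuts [l] into a prefix [l0], the partner and the enclosed word [x]. The
    value [g] is an exact product; perturbations are absorbed by the prefix. *)
Definition last_deleted_or_matched l p e g r : Prop :=
  (exists z y, Gam e z y /\ near l (g ** (p ** y ** z^-1 ** p^-1)^-1) (r - K)) \/
  (exists l0 p0 x g0 r0 b r1 y,
    l = l0 ++ (p0, negb e) :: x /\ near l0 g0 r0 /\ near x b r1 /\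
    Gam (negb e) (p0^-1 ** b ** p) y /\ g = g0 ** p0 ** y ** p^-1 /\ r0 + r1 <= r).

Lemma last_deleted_or_matched_approx l p e g r g' r' :
  last_deleted_or_matched l p e g r -> r + d g g' <= r' ->
  last_deleted_or_matched l p e g' r'.
Proof.
  intros [(z & y & E & N)|(l0 & p0 & x & g0 & r0 & b & r1 & y & -> & N0 & N1 & E & -> & L0)] L.
  - left. exists z, y. split; [exact E|].
    apply (near_approx _ _ _ _ _ N).
    rewrite <- (gmul_one_l _ g) at 1. rewrite <- (gmul_one_l _ g') at 1.
    rewrite d_shift. lra.
  - right. exists l0, p0, x, (g' ** p ** y^-1 ** p0^-1), (r' - r1), b, r1, y.
    split; [reflexivity|]. split; [|split; [exact N1|split; [exact E|split; [group|lra]]]].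
    apply (near_approx _ _ _ _ _ N0).
    rewrite <- (d_shift gone (p0 ** y ** p^-1) g0).
    replace (gone ** (g' ** p ** y^-1 ** p0^-1) ** (p0 ** y ** p^-1)) with g' by group.
    replace (gone ** g0 ** (p0 ** y ** p^-1)) with (g0 ** p0 ** y ** p^-1) by group.
    lra.
Qed.

(** A product is analysed in its right factor, unless that factor is empty and thus only a
    perturbation by [near_nil_dist]. *)
Lemma near_last l p e g r :
  near (l ++ [(p, e)]) g r -> last_deleted_or_matched l p e g r.
Proof.
  intro N. remember (l ++ [(p, e)]) as w eqn:Ew. revert l Ew.
  induction N as [|l1 h r l' h' r' N1 I1 N2 I2|p' e' z y E|p' q e' l1 h r y N I E|l1 h r h' r' N I L];
    intros l Ew.
  - now destruct l.
  - destruct (app_eq_middle _ _ _ _ _ Ew) as [(m & -> & Em)|(m & -> & ->)].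
    + symmetry in Em. apply app_eq_nil in Em as [-> ->].
      apply (last_deleted_or_matched_approx _ _ _ _ _ _ _ (I1 _ eq_refl)).
      apply near_nil_dist in N2. rewrite <- (d_shift h gone) in N2.
      rewrite !gmul_one_r in N2. lra.
    + destruct (I2 _ eq_refl)
        as [(z & y & E & N)|(l0 & p0 & x & g0 & r0 & b & r1 & y & -> & N0 & N & E & -> & L0)].
      * left. exists z, y. split; [exact E|].
        apply (near_app_eq _ _ _ _ _ _ _ _ N1 N); [group|lra].
      * right. exists (l1 ++ l0), p0, x, (h ** g0), (r + r0), b, r1, y.
        rewrite <- app_assoc. do 2 (split; [reflexivity || now apply near_app|]).
        do 3 (split; [assumption || group|]). lra.
  - apply (app_inj_tail [] l) in Ew as [<- [= -> ->]]. left. exists z, y.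
    split; [exact E|]. apply (near_eq _ _ _ _ _ near_nil); [group|lra].
  - apply (app_inj_tail ((p', e') :: l1) l) in Ew as [<- [= -> <-]]. right.
    exists [], p', l1, gone, 0, h, r, y. rewrite negb_involutive.
    do 5 (split; [reflexivity || assumption || apply near_nil || group|]). lra.
  - exact (last_deleted_or_matched_approx _ _ _ _ _ _ _ (I _ Ew) L).
Qed.

Lemma near_first l p e g r :
  near ((p, e) :: l) g r ->
  (exists z y, Gam e z y /\ near l ((p ** y ** z^-1 ** p^-1)^-1 ** g) (r - K)) \/
  (exists x q l0 b r1 g0 r0 y,
    l = x ++ (q, negb e) :: l0 /\ near x b r1 /\ near l0 g0 r0 /\
    Gam e (p^-1 ** b ** q) y /\ g = p ** y ** q^-1 ** g0 /\ r1 + r0 <= r).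
Proof.
  intro N. apply near_mirror in N. rewrite mirror_cons in N.
  destruct (near_last _ _ _ _ _ N)
    as [(z & y & E & N')|(l0 & p0 & x & g0 & r0 & b & r1 & y & El & N0 & N1 & E & Eg & L0)].
  - left. exists y, z. apply Gam_flip in E. rewrite negb_involutive in E. split; [exact E|].
    apply near_mirror in N'. rewrite mirror_mirror in N'.
    apply (near_eq _ _ _ _ _ N'); [group|lra].
  - right. exists (mirror x), p0, (mirror l0), b^-1, r1, g0^-1, r0, y^-1.
    cbn in E, El. rewrite negb_involutive in E, El.
    split. { rewrite <- (mirror_mirror l), El, mirror_app, mirror_cons, <- app_assoc. reflexivity. }
    do 2 (split; [now apply near_mirror|]).
    split. { apply Gam_inv in E. revert E. group_nf. auto. }
    split; [|lra]. rewrite <- (ginv_ginv g), Eg. group.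
Qed.

(** The insertion point lies either beside a matched or deleted letter or inside a bracket, so the
    free word [z] becomes an extra factor of some product. *)
Lemma near_insert l1 z l2 h r :
  near (l1 ++ l2) h r -> near z gone 0 -> near (l1 ++ z ++ l2) h r.
Proof.
  intros N Nz. remember (l1 ++ l2) as w eqn:Ew. revert l1 l2 Ew.
  assert (Hl : forall w h r, near w h r -> near (z ++ w) h r).
  { intros w' h' r' N'. apply (near_app_eq _ _ _ _ _ _ _ _ Nz N'); [group|lra]. }
  assert (Hr : forall w h r, near w h r -> near (w ++ z) h r).
  { intros w' h' r' N'. apply (near_app_eq _ _ _ _ _ _ _ _ N' Nz); [group|lra]. }
  induction N as [|w1 h r w2 h' r' N1 I1 N2 I2|p e x y E|p q e w h r y N I E|w h r h' r' N I L];
    intros l1 l2 Ew.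
  - symmetry in Ew. apply app_eq_nil in Ew as [-> ->]. apply Hl, near_nil.
  - destruct (app_eq_app _ _ _ _ Ew) as [m [[-> ->]|[-> ->]]].
    + rewrite !app_assoc, <- (app_assoc l1). apply near_app; auto.
    + rewrite <- app_assoc. apply near_app; auto.
  - symmetry in Ew. apply app_eq_unit in Ew as [[-> ->]|[-> ->]].
    + now apply Hl, near_del.
    + rewrite app_nil_r. now apply Hr, near_del.
  - destruct l1 as [|a l1].
    + cbn in Ew. subst l2. now apply Hl, near_bracket with h.
    + destruct l2 as [|b l2 _] using rev_ind.
      * rewrite app_nil_r in Ew |- *. rewrite <- Ew. now apply Hr, near_bracket with h.
      * injection Ew as <- Ew. rewrite app_assoc in Ew.
        apply app_inj_tail in Ew as [-> <-].
        cbn. rewrite !app_assoc, <- (app_assoc l1). apply near_bracket with h; auto.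
  - exact (near_approx _ _ _ _ _ (I _ _ Ew) L).
Qed.

(** * Invariance under the relations *)

(* The case of cancellation where [(p, e)] is bracketed with [(q, negb e)] and
   [(p, negb e)] is the first letter inside that bracket. *)
Lemma near_cancel_bracket p e w q h r y :
  near ((p, negb e) :: w) h r -> Gam e (p^-1 ** h ** q) y ->
  near (w ++ [(q, negb e)]) (p ** y ** q^-1) r.
Proof.
  intros N E.
  destruct (near_first _ _ _ _ _ N)
    as [(z & x & Ez & N')|(x & q' & l0 & b & r1 & g0 & r0 & v & -> & N1 & N0 & Ev & -> & L)].
  - assert (Ew : Gam (negb e) (y^-1 ** z) ((p^-1 ** h ** q)^-1 ** x)) by auto.
    apply (near_app_eq _ _ _ _ _ _ _ _ N' (near_del q _ _ _ Ew)); [group|lra].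
  - assert (E' : Gam e (v^-1 ** (p^-1 ** (p ** v ** q'^-1 ** g0) ** q)) ((p^-1 ** b ** q')^-1 ** y)).
    { apply Gam_flip in Ev. rewrite negb_involutive in Ev. auto. }
    rewrite negb_involutive, <- app_assoc.
    apply (near_app_eq _ b r1 ((q', e) :: l0 ++ [(q, negb e)])
      (q' ** ((p^-1 ** b ** q')^-1 ** y) ** q^-1) r0); [exact N1| |group|exact L].
    apply (near_bracket_eq _ _ _ _ _ _ _ _ _ N0 E'); [group|reflexivity].
Qed.

(** The two cancelling letters lie in different factors. If both are deleted, the saving [2 * K]
    pays for a perturbation bounded by [Gam_dist]. If exactly one is deleted, the partner of the
    other is deleted instead. If both are matched, their partners are matched with each other. *)
Lemma near_cancel_app l1 p e l2 g r h s :
  near (l1 ++ [(p, e)]) g r -> near ((p, negb e) :: l2) h s ->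
  near (l1 ++ l2) (g ** h) (r + s).
Proof.
  intros N1 N2.
  destruct (near_last _ _ _ _ _ N1)
    as [(z & y & E & N)|(l0 & p0 & x & g0 & r0 & b & r1 & y & -> & N0 & Nx & E & -> & L)];
  destruct (near_first _ _ _ _ _ N2)
    as [(z' & y' & E' & N')|(x' & q & l0' & b' & r1' & g0' & r0' & y' & -> & Nx' & N0' & E' & -> & L')].
  - assert (Hc : d (z^-1 ** y') (y^-1 ** z') <= 2 * K).
    { apply Gam_flip in E'. rewrite negb_involutive in E'. apply (Gam_dist e). auto. }
    apply (near_approx _ _ _ _ _ (near_app _ _ _ _ _ _ N N')).
    rewrite <- (d_shift (g ** p ** z) ((z^-1 ** y')^-1 ** z^-1 ** p^-1 ** h)) in Hc.
    revert Hc. group_nf. rewrite d_sym. lra.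
  - assert (Ez : Gam e (y'^-1 ** z) ((p^-1 ** b' ** q)^-1 ** y)).
    { apply Gam_flip in E'. rewrite negb_involutive in E'. auto. }
    rewrite negb_involutive.
    apply (near_app_eq _ _ _ _ _ _ _ _ N
      (near_app _ _ _ _ _ _ Nx' (near_app _ _ _ _ _ _ (near_del q _ _ _ Ez) N0'))); [group|lra].
  - rewrite <- app_assoc.
    apply (near_app_eq _ _ _ _ _ _ _ _ N0 (near_app _ _ _ _ _ _
      (near_del p0 _ _ _ (Gam_mul _ _ _ _ _ E E')) (near_app _ _ _ _ _ _ Nx N'))); [group|lra].
  - pose proof (near_bracket p0 q (negb e) _ (b ** b') _ (y ** y') (near_app _ _ _ _ _ _ Nx Nx'))
      as Nb.
    assert (Eb : Gam (negb e) (p0^-1 ** (b ** b') ** q) (y ** y')).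
    { replace (p0^-1 ** (b ** b') ** q) with (p0^-1 ** b ** p ** (p^-1 ** b' ** q)) by group. auto. }
    specialize (Nb Eb).
    replace ((l0 ++ (p0, negb e) :: x) ++ x' ++ (q, negb (negb e)) :: l0')
      with (l0 ++ ((p0, negb e) :: (x ++ x') ++ [(q, negb (negb e))]) ++ l0')
      by now cbn; rewrite <- !app_assoc.
    apply (near_app_eq _ _ _ _ _ _ _ _ N0 (near_app _ _ _ _ _ _ Nb N0')); [group|lra].
Qed.

Lemma near_cancel l1 p e l2 h r :
  near (l1 ++ (p, e) :: (p, negb e) :: l2) h r -> near (l1 ++ l2) h r.
Proof.
  intro N. remember (l1 ++ (p, e) :: (p, negb e) :: l2) as w eqn:Ew. revert l1 l2 Ew.
  induction N as [|w1 h r w2 h' r' N1 I1 N2 I2|p' f x y E|p' q f w h r y N I E|w h r h' r' N I L];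
    intros l1 l2 Ew.
  - now destruct l1.
  - destruct (app_eq_middle _ _ _ _ _ Ew) as [([|a m] & -> & Em)|(m & -> & ->)].
    + cbn in Em. subst w2. now apply near_cancel_app with p e.
    + injection Em as <- ->. rewrite app_assoc. apply near_app; auto.
    + rewrite <- app_assoc. apply near_app; auto.
  - apply (f_equal (@length _)) in Ew. rewrite length_app in Ew. cbn in Ew.
    rewrite !Nat.add_succ_r in Ew. discriminate.
  - destruct (bracket_eq_middle _ _ _ _ _ _ Ew)
      as [(-> & [= -> ->] & E2)|[(E2 & _ & _)|(m1 & m2 & -> & E2 & ->)]].
    + destruct w as [|a w].
      (* The two letters are matched with each other around the empty word; since [Gam] is
         isometric, [y] is as close to the identity as [h]. *)
      * injection E2 as <- ->. apply near_nil_dist in N.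
        assert (Hy : d y gone = d h gone).
        { rewrite <- (Gam_isom _ _ _ _ _ E (Gam_one e)).
          rewrite <- (d_shift p^-1 p h). f_equal; group. }
        apply (near_approx _ _ _ _ _ near_nil). rewrite d_sym.
        rewrite <- (d_shift p p^-1) in Hy. revert Hy. group_nf. rewrite (d_sym h). lra.
      * injection E2 as <- ->. now apply near_cancel_bracket with h.
    + discriminate.
    + destruct m2 as [|a m2].
      (* The second letter closes the bracket: the mirror image of [near_cancel_bracket]. *)
      * injection E2 as <- Ef ->. rewrite app_nil_r.
        apply (f_equal negb) in Ef. rewrite !negb_involutive in Ef. subst f.
        rewrite <- (mirror_mirror ((p', e) :: m1)). apply near_mirror in N.
        rewrite mirror_app in N. cbn in N.
        assert (E' : Gam e (p^-1 ** h^-1 ** p') y^-1).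
        { apply Gam_inv in E. revert E. group_nf. auto. }
        pose proof (near_mirror _ _ _ (near_cancel_bracket _ _ _ _ _ _ _ N E')) as N'.
        apply (near_eq _ _ _ _ _ N'); [group|lra].
      * injection E2 as <- ->.
        cbn. rewrite app_assoc. apply near_bracket with h; auto.
  - exact (near_approx _ _ _ _ _ (I _ _ Ew) L).
Qed.

(* In the extension, [t^e c = a t^e] for [Gam e c a]; moving [a] out of the
   position of a letter multiplies everything to the right of it by [k]. *)
Lemma near_commute l1 p e c a l2 h r k :
  Gam e c a -> k = p ** c ** a^-1 ** p^-1 ->
  near (l1 ++ (p ** a, e) :: l2) h r -> near (l1 ++ (p, e) :: shift k l2) (h ** k^-1) r.
Proof.
  intros Ea Hk N. remember (l1 ++ (p ** a, e) :: l2) as w eqn:Ew. revert l1 l2 Ew.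
  induction N as [|w1 h r w2 h' r' N1 I1 N2 I2|p' f x y E|p' q f w h r y N I E|w h r h' r' N I L];
    intros l1 l2 Ew.
  - now destruct l1.
  - destruct (app_eq_middle _ _ _ _ _ Ew) as [(m & -> & ->)|(m & -> & ->)].
    + unfold shift. rewrite map_app, app_comm_cons, app_assoc.
      apply (near_app_eq _ _ _ _ _ _ _ _ (I1 _ _ eq_refl) (near_conj k _ _ _ N2)); [group|lra].
    + rewrite <- app_assoc.
      apply (near_app_eq _ _ _ _ _ _ _ _ N1 (I2 _ _ eq_refl)); [group|lra].
  - symmetry in Ew. apply app_eq_unit in Ew as [[-> Ew]|[_ Ew]]; [|discriminate].
    injection Ew as <- <- ->. cbn.
    apply (near_del_eq _ _ _ _ _ (Gam_mul _ _ _ _ _ Ea E)). subst k. group.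
  - destruct (bracket_eq_middle _ _ _ _ _ _ Ew)
      as [(-> & [= -> ->] & ->)|[(-> & [= -> Ef] & ->)|(m1 & m2 & -> & -> & ->)]].
    (* An opening letter: the pair [(c, a)] multiplies the bracket relation on the left and the
       content is conjugated by [k]. For a closing letter, below, its flipped inverse multiplies on
       the right. *)
    + unfold shift. rewrite map_app.
      apply (near_bracket_eq _ _ _ _ _ _ _ _ _ (near_conj k _ _ _ N)
        (Gam_mul _ _ _ _ _ Ea E)); subst k; group.
    + subst e. cbn. apply Gam_flip in Ea. rewrite negb_involutive in Ea.
      apply (near_bracket_eq _ _ _ _ _ _ _ _ _ N
        (Gam_mul _ _ _ _ _ E (Gam_inv _ _ _ Ea))); subst k; group.
    + unfold shift. rewrite map_app. cbn. rewrite (app_comm_cons _ _ (p, e)), app_assoc.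
      apply (near_bracket_eq _ _ _ _ _ _ _ _ _ (I _ _ eq_refl) E); group.
  - apply (near_approx _ _ _ _ _ (I _ _ Ew)).
    rewrite <- (d_shift gone k^-1 h h') in L. revert L. group_nf. auto.
Qed.

Lemma near_commute_iff l1 p e c a l2 h r :
  Gam e c a ->
  near (l1 ++ (p ** a, e) :: l2) h r <->
  near (l1 ++ (p, e) :: shift (p ** c ** a^-1 ** p^-1) l2) (h ** (p ** c ** a^-1 ** p^-1)^-1) r.
Proof.
  intro E. split; [intro N; now apply near_commute with c a|]. intro N.
  (* The converse is the same move for the inverse pair, whose shift undoes that by [k]. *)
  replace p with (p ** a ** a^-1) in N at 1 by group.
  apply (near_commute _ _ _ c^-1 _ _ _ _ (p ** c ** a^-1 ** p^-1)^-1 (Gam_inv _ _ _ E)) in N.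
  - rewrite shift_shift, gmul_inv_l, shift_one in N.
    apply (near_eq _ _ _ _ _ N); [group|lra].
  - group.
Qed.

Lemma near_cancel_iff l1 p e l2 h r :
  near (l1 ++ (p, e) :: (p, negb e) :: l2) h r <-> near (l1 ++ l2) h r.
Proof.
  split; [apply near_cancel|]. intro N.
  apply (near_insert _ [(p, e); (p, negb e)] _ _ _ N).
  apply (near_bracket_eq _ _ _ _ _ _ _ _ _ near_nil (Gam_one e)); group.
Qed.

(** * Lower bounds *)

Fixpoint exponent_sum l : R :=
  match l with [] => 0 | (_, e) :: l => (if e then 1 else -1) + exponent_sum l end.

Lemma exponent_sum_app l l' : exponent_sum (l ++ l') = exponent_sum l + exponent_sum l'.
Proof. induction l as [|[p e] l IH]; cbn; [|rewrite IH]; lra. Qed.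

(** Matched letters have opposite exponents, and each deletion changes the sum by one at the price
    [K]. *)
Lemma near_exponent_sum l h r :
  near l h r -> - r <= K * exponent_sum l <= r.
Proof.
  induction 1 as [|l h r l' h' r' N1 I1 N2 I2|p e z y E|p q e l h r y N I E|l h r h' r' N I L].
  - cbn. lra.
  - rewrite exponent_sum_app. lra.
  - destruct e; cbn; lra.
  - cbn. rewrite exponent_sum_app. destruct e; cbn; lra.
  - pose proof (d_nonneg h h'). lra.
Qed.

Definition separated (delta : R) l : Prop :=
  forall l1 p e q l2 x y, l = l1 ++ (p, e) :: (q, negb e) :: l2 ->
    Gam e x y -> delta <= d (p^-1 ** q) x.

Lemma separated_infix delta l1 l l2 :
  separated delta (l1 ++ l ++ l2) -> separated delta l.
Proof.
  intros S m1 p e q m2 x y -> E. apply (S (l1 ++ m1) p e q (m2 ++ l2) x y); [|exact E].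
  now rewrite <- !app_assoc.
Qed.

(** Either some letter is deleted, at cost [K], or an innermost bracket encloses the empty word, and
    turning its content into an element related by [Gam] costs at least [delta]. *)
Lemma near_separated delta l h r :
  near l h r -> separated delta l -> l <> [] -> Rmin K delta <= r.
Proof.
  induction 1 as [|l h r l' h' r' N1 I1 N2 I2|p e z y E|p q e l h r y N I E|l h r h' r' N I L];
    intros S Hl.
  - now contradict Hl.
  - apply near_nonneg in N1 as P1. apply near_nonneg in N2 as P2.
    destruct l as [|a l].
    + specialize (I2 S Hl). lra.
    + assert (S1 : separated delta (a :: l)) by (now apply (separated_infix delta [] _ l')).
      specialize (I1 S1 ltac:(discriminate)). lra.
  - apply Rmin_l.
  - destruct l as [|a l].
    + apply near_nil_dist in N.
      pose proof (S [] _ _ _ [] _ _ eq_refl E) as D.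
      rewrite <- (d_shift p^-1 q) in N. rewrite gmul_one_r in N.
      pose proof (Rmin_r K delta). lra.
    + apply I; [|discriminate]. now apply (separated_infix delta [(p, e)] _ [(q, negb e)]).
  - pose proof (d_nonneg h h'). specialize (I S Hl). lra.
Qed.

(** A word has finitely many adjacent pairs, and for each that could be a pinch, closedness gives a
    positive distance to the domain of [Gam e]. *)
Lemma separated_of_closed l :
  (forall e u, (forall eps, 0 < eps -> exists x y, Gam e x y /\ d u x < eps) ->
    exists y, Gam e u y) ->
  (forall l1 p e q l2 y, l = l1 ++ (p, e) :: (q, negb e) :: l2 -> ~ Gam e (p^-1 ** q) y) ->
  exists delta, 0 < delta /\ separated delta l.
Proof.
  intros Hcl. induction l as [|[p e] l IH]; intro Hl.
  { exists 1. split; [lra|]. intros [|? ?]; discriminate. }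
  destruct IH as (delta & Hdelta & S).
  { intros l1 p' e' q l2 y ->. apply (Hl ((p, e) :: l1) p' e' q l2 y eq_refl). }
  assert (D : exists eps, 0 < eps /\ forall q l2 x y, l = (q, negb e) :: l2 -> Gam e x y ->
    eps <= d (p^-1 ** q) x).
  { destruct l as [|[q f] l]; [exists 1; split; [lra|discriminate]|].
    destruct (classic (f = negb e)) as [->|Hf]; [|exists 1; split; [lra|congruence]].
    apply NNPP. intro Hn. destruct (Hcl e (p^-1 ** q)) as [y E].
    - intros eps Heps. apply NNPP. intro Hx. apply Hn. exists eps. split; [exact Heps|].
      intros q' l2 x y [= -> ->] E. apply Rnot_lt_le. intro Hlt. apply Hx. eauto.
    - exact (Hl [] p e q l y eq_refl E). }
  destruct D as (eps & Heps & D).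
  exists (Rmin eps delta). split; [now apply Rmin_glb_lt|].
  intros [|a l1] p' e' q l2 x y El E.
  - injection El as -> -> ->. eapply Rle_trans; [apply Rmin_l|eauto].
  - injection El as <- ->. eapply Rle_trans; [apply Rmin_r|].
    exact (S l1 p' e' q l2 x y eq_refl E).
Qed.


(** * The norm on the extension *)

Section Extension.
Context {H : Group} (i : G -> H) (t : H) (Hi : is_hom i)
  (Ht : forall x y, Gam true x y -> t ** i x ** t^-1 = i y)
  (Huniv : forall (L : Group) (j : G -> L) (s : L), is_hom j ->
    (forall x y, Gam true x y -> s ** j x ** s^-1 = j y) ->
    exists f : H -> L, (is_hom f /\ (forall g, f (i g) = j g) /\ f t = s) /\
      forall f' : H -> L, is_hom f' -> (forall g : G, f' (i g) = j g) -> f' t = s ->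
        forall x : H, f' x = f x)
  (Gam_closed : forall e u,
    (forall eps, 0 < eps -> exists x y, Gam e x y /\ d u x < eps) -> exists y, Gam e u y).

(** * Evaluation of words in the extension *)

Definition tpow e : H := if e then t else t^-1.

Lemma tpow_negb e : tpow (negb e) = (tpow e)^-1.
Proof. destruct e; cbn; [reflexivity|group]. Qed.

Lemma tpow_commute e x y : Gam e x y -> tpow e ** i x = i y ** tpow e.
Proof.
  destruct e; cbn; intro E.
  - rewrite <- (Ht _ _ E). group.
  - apply Gam_flip in E. rewrite <- (Ht _ _ E). group.
Qed.

Fixpoint eval l : H :=
  match l with [] => gone | (p, e) :: l => i p ** tpow e ** (i p)^-1 ** eval l end.

Lemma eval_app l l' : eval (l ++ l') = eval l ** eval l'.
Proof. induction l as [|[p e] l IH]; cbn; [|rewrite IH]; group. Qed.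

Lemma eval_shift k l : eval (shift k l) = i k ** eval l ** (i k)^-1.
Proof.
  induction l as [|[p e] l IH]; [cbn; group|].
  change (shift k ((p, e) :: l)) with ((k ** p, e) :: shift k l).
  cbn [eval]. rewrite IH, Hi. group.
Qed.

Lemma eval_mirror l : eval (mirror l) = (eval l)^-1.
Proof.
  induction l as [|[p e] l IH]; [cbn; group|].
  rewrite mirror_cons, eval_app, IH. unfold flip. cbn [fst snd eval].
  rewrite tpow_negb. group.
Qed.

Lemma eval_cancel l1 p e l2 : eval (l1 ++ (p, e) :: (p, negb e) :: l2) = eval (l1 ++ l2).
Proof. rewrite !eval_app. cbn [eval]. rewrite tpow_negb. group. Qed.

(** From [t^e c = a t^e], the letter at [p ** a] equals the letter at [p] followed by [k]; carrying
    [k] to the far right conjugates the letters of [l2]. *)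
Lemma eval_commute l1 p e c a l2 g k :
  Gam e c a -> k = p ** c ** a^-1 ** p^-1 ->
  eval (l1 ++ (p ** a, e) :: l2) ** i g = eval (l1 ++ (p, e) :: shift k l2) ** i (k ** g).
Proof.
  intros E ->. rewrite !eval_app. cbn [eval]. rewrite eval_shift, !Hi, !(hom_inv i) by exact Hi.
  pose proof (tpow_commute _ _ _ E) as Ec.
  group_nf. do 2 f_equal.
  rewrite (gmul_assoc _ (tpow e) (i c)), Ec. group.
Qed.

Lemma eval_insert p e q l g :
  (i p ** tpow e ** (i p)^-1) ** (eval l ** i g) ** (i q ** tpow (negb e) ** (i q)^-1) =
  eval ((p, e) :: l ++ [(g ** q, negb e)]) ** i g.
Proof. cbn [eval]. rewrite eval_app. cbn [eval]. rewrite !Hi. group. Qed.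

(* The right translates of [F] by words are permuted by [G] and [t]; equal
   elements of the extension translate [near] equally. *)
Definition invariant (F : word -> G -> R -> Prop) : Prop :=
  (forall l1 p e l2 g, F (l1 ++ (p, e) :: (p, negb e) :: l2) g = F (l1 ++ l2) g) /\
  (forall l1 p e c a l2 g, Gam e c a ->
    F (l1 ++ (p ** a, e) :: l2) g =
    F (l1 ++ (p, e) :: shift (p ** c ** a^-1 ** p^-1) l2) (p ** c ** a^-1 ** p^-1 ** g)).

Definition act l' g' (F : word -> G -> R -> Prop) : word -> G -> R -> Prop :=
  fun l g => F (l ++ shift g l') (g ** g').

Lemma act_invariant l' g' F : invariant F -> invariant (act l' g' F).
Proof.
  intros [F1 F2]. unfold act. split.
  - intros. rewrite <- !app_assoc. apply F1.
  - intros l1 p e c a l2 g E. rewrite <- !app_assoc. cbn [app].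
    rewrite (F2 _ _ _ _ _ _ _ E), shift_app, shift_shift. f_equal. group.
Qed.

Lemma act_act l1 g1 l2 g2 F :
  act l1 g1 (act l2 g2 F) = act (l1 ++ shift g1 l2) (g1 ** g2) F.
Proof.
  unfold act. apply functional_extensionality; intro l.
  apply functional_extensionality; intro g.
  rewrite shift_app, shift_shift, app_assoc. f_equal. group.
Qed.

Lemma act_one F : act [] gone F = F.
Proof.
  unfold act. apply functional_extensionality; intro l.
  apply functional_extensionality; intro g. cbn. now rewrite app_nil_r, gmul_one_r.
Qed.

(** The pair [(l, g)] stands for the product of [l] and [g]; this becomes trivial when [l] is moved
    to [g^-1]. *)
Lemma near_invariant : invariant (fun l g => near l g^-1).
Proof.
  split.
  - intros. apply functional_extensionality; intro r.
    apply propositional_extensionality, near_cancel_iff.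
  - intros l1 p e c a l2 g E. apply functional_extensionality; intro r.
    apply propositional_extensionality. rewrite (near_commute_iff _ _ _ _ _ _ _ _ E).
    rewrite (ginv_mul (p ** c ** a^-1 ** p^-1)).
    reflexivity.
Qed.

(** * The extension acting by permutations of the invariant functions *)

Definition invariant_function : Type := {F | invariant F}.

Lemma invariant_function_eq (F F' : invariant_function) :
  proj1_sig F = proj1_sig F' -> F = F'.
Proof.
  destruct F as [F HF], F' as [F' HF']. cbn. intros <-. f_equal. apply proof_irrelevance.
Qed.

Definition act_inv l g (F : invariant_function) : invariant_function :=
  exist _ (act l g (proj1_sig F)) (act_invariant l g _ (proj2_sig F)).

Lemma act_G_cancel g g' (F : invariant_function) :
  g ** g' = gone -> act_inv [] g (act_inv [] g' F) = F.
Proof.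
  intro E. apply invariant_function_eq. cbn. rewrite act_act, E. apply act_one.
Qed.

Definition act_G g : symmetric_group invariant_function :=
  {| fwd := act_inv [] g; bwd := act_inv [] g^-1;
    bwd_fwd F := act_G_cancel _ _ F (gmul_inv_l _ g);
    fwd_bwd F := act_G_cancel _ _ F (gmul_inv_r _ g) |}.

Lemma act_t_cancel e (F : invariant_function) :
  act_inv [(gone, e)] gone (act_inv [(gone, negb e)] gone F) = F.
Proof.
  apply invariant_function_eq. cbn. rewrite act_act.
  apply functional_extensionality; intro l. apply functional_extensionality; intro g.
  unfold act. cbn. rewrite !gmul_one_l, !gmul_one_r.
  destruct F as [F [F1 F2]]. cbn. now rewrite F1, app_nil_r.
Qed.

Definition act_t : symmetric_group invariant_function :=
  {| fwd := act_inv [(gone, true)] gone; bwd := act_inv [(gone, false)] gone;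
    bwd_fwd := act_t_cancel false; fwd_bwd := act_t_cancel true |}.

Lemma act_G_hom : @is_hom G (symmetric_group invariant_function) act_G.
Proof.
  intros x y. apply permutation_eq. intro F. apply invariant_function_eq.
  cbn. now rewrite act_act.
Qed.

Lemma act_t_relation x y : Gam true x y ->
  @gmul (symmetric_group invariant_function)
    (@gmul (symmetric_group invariant_function) act_t (act_G x)) (ginv act_t) = act_G y.
Proof.
  intro E. apply permutation_eq. intro F. apply invariant_function_eq.
  cbn. rewrite !act_act. apply functional_extensionality; intro l.
  apply functional_extensionality; intro g. unfold act. cbn.
  group_nf. destruct F as [F [F1 F2]]. cbn.
  (* The letter [(g ** x, false)] is moved to [(g, false)], which then cancels against
     [(g, true)]. *)
  pose proof (F2 (l ++ [(g, true)]) g false y x [] (g ** x) (Gam_flip _ _ _ E)) as Ex.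
  rewrite <- !app_assoc in Ex. cbn in Ex. rewrite Ex.
  pose proof (F1 l g true [] (g ** y)) as Ey. cbn in Ey.
  rewrite app_nil_r in *. rewrite <- Ey. f_equal. group.
Qed.

Lemma eval_act (f : H -> symmetric_group invariant_function) :
  is_hom f -> (forall g : G, f (i g) = act_G g) -> f t = act_t ->
  forall l g F, proj1_sig (fwd _ (f (eval l ** i g)) F) = act l g (proj1_sig F).
Proof.
  intros Hf Hfi Hft l g F.
  assert (Htpow : forall e, fwd _ (f (tpow e)) = act_inv [(gone, e)] gone).
  { intros []; cbn; [now rewrite Hft|]. now rewrite (hom_inv f), Hft. }
  induction l as [|[p e] l IH].
  - cbn [eval]. now rewrite gmul_one_l, Hfi.
  - cbn [eval]. rewrite gmul_assoc_r.
    set (x := eval l ** i g) in *. clearbody x.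
    rewrite !Hf, <- (hom_inv i p Hi), !Hfi. cbn. rewrite Htpow. cbn. rewrite IH, !act_act.
    group_nf. rewrite shift_one. cbn. now rewrite gmul_one_r.
Qed.

(** Equal elements of the extension act by the same permutation; the translate of [F0], read at the
    empty word and the identity, recovers [near]. *)
Lemma near_eval l g l' g' r :
  eval l ** i g = eval l' ** i g' -> near l g^-1 r -> near l' g'^-1 r.
Proof.
  intros E N.
  destruct (Huniv _ act_G act_t act_G_hom act_t_relation) as (f & (Hf & Hfi & Hft) & _).
  pose (F0 := exist _ _ near_invariant : invariant_function).
  pose proof (eval_act f Hf Hfi Hft l g F0) as A.
  rewrite E, (eval_act f Hf Hfi Hft) in A.
  apply (f_equal (fun F => F [] gone r)) in A. unfold act in A. cbn in A.
  rewrite !shift_one, !gmul_one_l in A. now rewrite A.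
Qed.

(** The universal property maps [H] into the subgroup [S]; followed by the inclusion this is the
    identity, by uniqueness. *)
Lemma extension_ind (S : H -> Prop) :
  is_subgroup S -> (forall g : G, S (i g)) -> S t -> forall x, S x.
Proof.
  intros HS Si St.
  destruct (Huniv (subgroup_group S HS) (fun g => exist _ (i g) (Si g)) (exist _ t St))
    as (f & (Hf & Hfi & Hft) & _).
  - intros x y. apply subgroup_carrier_eq, Hi.
  - intros x y E. apply subgroup_carrier_eq. now apply Ht.
  - intro x. destruct (Huniv H i t Hi Ht) as (f0 & _ & U).
    rewrite (U (fun x => x)); [|red; reflexivity|reflexivity|reflexivity].
    rewrite <- (U (fun x => proj1_sig (f x))); [apply proj2_sig| | |].
    + intros x' y'. now rewrite Hf.
    + intro g. now rewrite Hfi.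
    + now rewrite Hft.
Qed.

(** * Costs of elements of the extension *)

Definition within (x : H) (r : R) : Prop :=
  exists l g, x = eval l ** i g /\ near l g^-1 r.

Lemma within_eval l g r : within (eval l ** i g) r <-> near l g^-1 r.
Proof.
  split; [|intro N; exists l, g; auto].
  intros (l' & g' & E & N). now apply (near_eval l' g').
Qed.

Lemma within_mul x r y s : within x r -> within y s -> within (x ** y) (r + s).
Proof.
  intros (l & g & -> & N) (l' & g' & -> & N').
  exists (l ++ shift g l'), (g ** g'). split.
  - rewrite eval_app, eval_shift, Hi. group.
  - apply (near_app_eq _ _ _ _ _ _ _ _ N (near_conj g _ _ _ N')); [group|lra].
Qed.

Lemma within_inv x r : within x r -> within x^-1 r.
Proof.
  intros (l & g & -> & N). exists (shift g^-1 (mirror l)), g^-1. split.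
  - rewrite eval_shift, eval_mirror, (hom_inv i g Hi). group.
  - apply near_mirror, (near_conj g^-1) in N.
    apply (near_eq _ _ _ _ _ N); [group|lra].
Qed.

Lemma within_conj_G k x r : within x r -> within (i k ** x ** (i k)^-1) r.
Proof.
  intros (l & g & -> & N). exists (shift k l), (k ** g ** k^-1). split.
  - rewrite eval_shift, !Hi, (hom_inv i k Hi). group.
  - apply (near_conj k) in N. apply (near_eq _ _ _ _ _ N); [group|lra].
Qed.

(** The two letters of the conjugating power are matched around the whole word; the enclosed element
    becomes trivial, so the bracket is free. *)
Lemma within_conj_tpow e x r : within x r -> within (tpow e ** x ** (tpow e)^-1) r.
Proof.
  intros (l & g & -> & N). exists ((gone, e) :: l ++ [(g, negb e)]), g. split.
  - rewrite <- (gmul_one_r _ g) at 2. rewrite <- eval_insert, (hom_one i Hi), tpow_negb. group.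
  - apply (near_bracket_eq _ _ _ _ _ _ _ _ _ N (Gam_one e)); group.
Qed.

Lemma within_conj u x r : within x r -> within (u ** x ** u^-1) r.
Proof.
  (* Both directions are carried along so that the set of admissible [u] is closed under
     inverses. *)
  revert x r. enough (W : forall x r, within x r ->
    within (u ** x ** u^-1) r /\ within (u^-1 ** x ** u) r) by (intros; now apply W).
  pattern u. apply extension_ind; clear u.
  - split; [|split].
    + intros x r N. revert N. group_nf. auto.
    + intros u v IHu IHv x r N. split.
      * destruct (IHv _ _ N) as [N1 _]. destruct (IHu _ _ N1) as [N2 _].
        revert N2. group_nf. auto.
      * destruct (IHu _ _ N) as [_ N1]. destruct (IHv _ _ N1) as [_ N2].
        revert N2. group_nf. auto.
    + intros u IHu x r N. rewrite ginv_ginv. split; now apply IHu.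
  - intros g x r N. split; [now apply within_conj_G|].
    apply (within_conj_G g^-1) in N. rewrite (hom_inv i g Hi), ginv_ginv in N. exact N.
  - intros x r N. split; [now apply (within_conj_tpow true)|].
    apply (within_conj_tpow false) in N. cbn in N. rewrite ginv_ginv in N. exact N.
Qed.

Lemma within_exists x : exists r, within x r.
Proof.
  pattern x. apply extension_ind; clear x.
  - split; [|split].
    + exists 0, [], gone. split; [cbn; rewrite (hom_one i Hi); group|].
      apply (near_eq _ _ _ _ _ near_nil); [group|lra].
    + intros x y [r N] [s N']. exists (r + s). now apply within_mul.
    + intros x [r N]. exists r. now apply within_inv.
  - intro g. exists (d gone g^-1), [], g. split; [cbn; group|].
    apply (near_approx _ _ _ _ _ near_nil). lra.
  - exists K, [(gone, true)], gone. split.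
    + cbn. rewrite (hom_one i Hi). group.
    + apply (near_del_eq _ _ _ _ _ (Gam_one true)). group.
Qed.

Lemma within_nonneg x r : within x r -> 0 <= r.
Proof. intros (l & g & _ & N). now apply near_nonneg in N. Qed.

Lemma within_one : within gone 0.
Proof.
  exists [], gone. split; [cbn; rewrite (hom_one i Hi); group|].
  apply (near_eq _ _ _ _ _ near_nil); [group|lra].
Qed.

Lemma within_G g : within (i g) (d g gone).
Proof.
  exists [], g. split; [cbn; group|].
  apply (near_approx _ _ _ _ _ near_nil). rewrite <- (d_inv g), ginv_one, d_sym. lra.
Qed.

Lemma within_G_ge g r : within (i g) r -> d g gone <= r.
Proof.
  intro W. rewrite <- (gmul_one_l _ (i g)) in W. apply (within_eval [] g), near_nil_dist in W.
  now rewrite d_sym, <- d_inv, ginv_one.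
Qed.

Lemma eval_letter_t : eval [(gone, true)] ** i gone = t.
Proof. cbn. rewrite (hom_one i Hi). group. Qed.

Lemma within_t : within t K.
Proof.
  rewrite <- eval_letter_t. apply within_eval.
  apply (near_del_eq _ _ _ _ _ (Gam_one true)). group.
Qed.

Lemma within_t_ge r : within t r -> K <= r.
Proof.
  intro W. rewrite <- eval_letter_t in W. apply within_eval, near_exponent_sum in W.
  cbn in W. lra.
Qed.

(** Induction on length: a pinch is removed by the two relations. A word without pinches either is
    empty, and [d g gone] is the bound, or has letters and is separated. *)
Lemma within_pos l g :
  eval l ** i g <> gone -> exists eps, 0 < eps /\ forall r, within (eval l ** i g) r -> eps <= r.
Proof.
  remember (length l) as n eqn:En. revert l g En.
  induction n as [n IH] using (well_founded_induction Wf_nat.lt_wf). intros l g -> Hne.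
  destruct (classic (exists l1 p e q l2 y,
    l = l1 ++ (p, e) :: (q, negb e) :: l2 /\ Gam e (p^-1 ** q) y))
    as [(l1 & p & e & q & l2 & y & -> & E)|Hred].
  - apply Gam_flip in E.
    assert (Ee : eval (l1 ++ (p, e) :: (q, negb e) :: l2) ** i g =
      eval (l1 ++ shift (p ** y ** (p^-1 ** q)^-1 ** p^-1) l2) **
        i (p ** y ** (p^-1 ** q)^-1 ** p^-1 ** g)).
    { rewrite <- (eval_cancel l1 p e (shift _ l2)).
      (* Moving [p^-1 ** q] out of the second letter puts it at [p], where it cancels with the
         first. *)
      replace q with (p ** (p^-1 ** q)) at 1 by group.
      pose proof (eval_commute (l1 ++ [(p, e)]) p _ _ _ l2 g _ E eq_refl) as Ec.
      rewrite <- !app_assoc in Ec. exact Ec. }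
    rewrite Ee in Hne |- *. apply (IH _) with (2 := eq_refl); [|exact Hne].
    unfold shift. rewrite !length_app, length_map. cbn. lia.
  - destruct l as [|a l].
    + exists (d g gone). cbn in Hne |- *. rewrite gmul_one_l in Hne |- *. split.
      * destruct (d_nonneg g gone) as [L|L]; [exact L|]. symmetry in L.
        apply Hd in L. subst g. now contradict Hne; apply hom_one.
      * apply within_G_ge.
    + destruct (separated_of_closed (a :: l) Gam_closed) as (delta & Hdelta & S).
      { intros l1 p e q l2 y El E. apply Hred. now exists l1, p, e, q, l2, y. }
      exists (Rmin K delta). split; [now apply Rmin_glb_lt|].
      intros r W. apply within_eval in W. now apply (near_separated _ _ _ _ W S).
Qed.

(** * The infimum of the costs as a conjugation invariant norm *)

Lemma within_inf x :
  {m : R | (forall r, within x r -> m <= r) /\ (forall c, (forall r, within x r -> c <= r) -> c <= m)}.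
Proof.
  (* The infimum is minus the supremum of the negated costs. *)
  destruct (completeness (fun s => within x (- s))) as [m [U L]].
  - exists 0. intros s W. apply within_nonneg in W. lra.
  - destruct (within_exists x) as [r W]. exists (- r). now rewrite Ropp_involutive.
  - exists (- m). split.
    + intros r W. rewrite <- (Ropp_involutive r) in W. apply U in W. lra.
    + intros c Hc. enough (m <= - c) by lra. apply L. intros s W. apply Hc in W. lra.
Qed.

Definition norm (x : H) : R := proj1_sig (within_inf x).

Lemma norm_le x r : within x r -> norm x <= r.
Proof. apply (proj2_sig (within_inf x)). Qed.

Lemma norm_ge x c : (forall r, within x r -> c <= r) -> c <= norm x.
Proof. apply (proj2_sig (within_inf x)). Qed.

Lemma norm_one : norm gone = 0.
Proof.
  apply Rle_antisym; [apply norm_le, within_one|apply norm_ge; intro; apply within_nonneg].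
Qed.

Lemma norm_eq_zero x : norm x = 0 -> x = gone.
Proof.
  intro E. apply NNPP. intro Hx. destruct (within_exists x) as (r & l & g & -> & _).
  destruct (within_pos l g Hx) as (eps & Heps & W). apply norm_ge in W. lra.
Qed.

Lemma norm_inv x : norm x^-1 = norm x.
Proof.
  apply Rle_antisym; apply norm_ge; intros r W; apply norm_le; apply within_inv in W;
    now rewrite ?ginv_ginv in *.
Qed.

Lemma norm_mul x y : norm (x ** y) <= norm x + norm y.
Proof.
  (* The infima over the costs of [x] and of [y] are taken one after the other. *)
  enough (norm (x ** y) - norm y <= norm x) by lra. apply norm_ge. intros r W.
  enough (norm (x ** y) - r <= norm y) by lra. apply norm_ge. intros s W'.
  pose proof (norm_le _ _ (within_mul _ _ _ _ W W')). lra.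
Qed.

Lemma norm_conj u x : norm (u ** x ** u^-1) = norm x.
Proof.
  apply Rle_antisym; apply norm_ge; intros r W; apply norm_le; [now apply within_conj|].
  apply (within_conj u^-1) in W. revert W. group_nf. auto.
Qed.

Lemma norm_G g : norm (i g) = d g gone.
Proof.
  apply Rle_antisym; [apply norm_le, within_G|apply norm_ge; intro; apply within_G_ge].
Qed.

Lemma norm_t : norm t = K.
Proof.
  apply Rle_antisym; [apply norm_le, within_t|apply norm_ge; intro; apply within_t_ge].
Qed.

Lemma extension_metric :
  exists d' : H -> H -> R, is_metric d' /\ two_sided_invariant d' /\
    (forall g1 g2 : G, d' (i g1) (i g2) = d g1 g2) /\ d' t gone = K.
Proof.
  (* Left invariance is immediate from this form; right invariance is the conjugation invariance of
     the norm. *)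
  exists (fun x y => norm (x^-1 ** y)). split; [|split; [|split]].
  - split; [|split; [|split]].
    + intros x y. apply norm_ge. intro. apply within_nonneg.
    + intros x y. split; intro E.
      * apply norm_eq_zero, ginv_unique in E. now rewrite E, ginv_ginv.
      * subst y. rewrite gmul_inv_l. apply norm_one.
    + intros x y. rewrite <- norm_inv. f_equal. group.
    + intros x y z. eapply Rle_trans; [|apply norm_mul]. right. f_equal. group.
  - intros g x y. split; [f_equal; group|].
    rewrite <- (norm_conj g^-1 (x^-1 ** y)). f_equal. group.
  - intros g1 g2. rewrite <- (hom_inv i g1 Hi), <- Hi, norm_G, d_sym.
    rewrite <- (d_shift g1 gone). f_equal; group.
  - rewrite gmul_one_r, norm_inv. apply norm_t.
Qed.

End Extension.

End Words.

(** * Specialisation to the graph of [phi] and its converse *)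

Theorem mainTheorem12
  (G : Group) (d : G -> G -> R)
  (Hd : is_metric d) (Hinv : two_sided_invariant d)
  (A B : G -> Prop)
  (HA : is_subgroup A) (HB : is_subgroup B)
  (HAc : is_closed d A) (HBc : is_closed d B)
  (phi : G -> G)
  (Hmaps : forall a, A a -> B (phi a))
  (Hhom : forall a1 a2, A a1 -> A a2 -> phi (gmul a1 a2) = gmul (phi a1) (phi a2))
  (Hinj : forall a1 a2, A a1 -> A a2 -> phi a1 = phi a2 -> a1 = a2)
  (Hsurj : forall b, B b -> exists a, A a /\ phi a = b)
  (Hisom : forall a1 a2, A a1 -> A a2 -> d (phi a1) (phi a2) = d a1 a2)
  (H : Group) (i : G -> H) (t : H)
  (HHNN : is_HNN_extension A phi H i t)
  (K : R) (HK : 0 < K) (Hdiam : diam_le d A K) :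
  exists d' : H -> H -> R,
    is_metric d' /\ two_sided_invariant d' /\
    (forall g1 g2, d' (i g1) (i g2) = d g1 g2) /\
    d' t gone = K.
Proof.
  destruct HA as (A1 & Am & Ai). destruct HHNN as (Hi & Ht & Huniv).
  assert (phi1 : phi gone = gone).
  { apply (gmul_cancel_l (phi gone)). now rewrite <- Hhom, !gmul_one_r. }
  assert (phiV : forall a, A a -> phi a^-1 = (phi a)^-1).
  { intros a Ha. apply ginv_unique. rewrite <- Hhom; auto. now rewrite gmul_inv_r. }
  apply (extension_metric d
    (fun e x y => if e then A x /\ y = phi x else A y /\ x = phi y) K Hd Hinv HK).
  - now intros [].
  - intros []; now split.
  - intros [] x y x' y' [Hx ->] [Hx' ->]; rewrite Hhom; auto.
  - intros [] x y [Hx ->]; rewrite phiV; auto.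
  - intros [] x y x' y' [Hx ->] [Hx' ->]; rewrite Hisom; auto.
  - intros [] x y [Hx ->]; [now apply Hdiam|]. rewrite <- phi1, Hisom; auto.
  - exact Hi.
  - intros x y [Hx ->]. now apply Ht.
  - intros L j s Hj Hs. apply Huniv; [exact Hj|]. intros a Ha. now apply Hs.
  (* The domain of the relation is [A] for the sign [true] and [B], the image of [A], for
     [false]. *)
  - intros [] u Hu.
    + exists (phi u). split; [|reflexivity]. apply HAc. intros eps Heps.
      destruct (Hu eps Heps) as (x & y & [Hx _] & D). now exists x.
    + destruct (Hsurj u) as (a & Ha & <-); [|now exists a].
      apply HBc. intros eps Heps.
      destruct (Hu eps Heps) as (x & y & [Hy ->] & D). exists (phi y). auto.
Qed.
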